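(* Let $s,v\in[0,1]$. Then $Hz_v\preceq H_s$ if and only if at least one of the following holds: (c1) $0\le s\le\frac12$, $\frac12\le v\le1$ and $2v-1\le\dfrac{\pi/2}{\pi-\cos^{-1}\left(\frac{s}{1-s}\right)}$; (c2) $0\le s\le\frac12$, $0\le v\le\frac12$ and $1-2v\le\dfrac{\pi/2}{\pi-\cos^{-1}\left(\frac{s}{1-s}\right)}$; (c3) $s=1$ and $v=\frac12$.
   Context: For $a,b>0$: the Heinz mean is $Hz_v(a,b)=\frac12\left(a^vb^{1-v}+a^{1-v}b^v\right)$ ($0\le v\le1$), and the Heron mean is $H_s(a,b)=s\sqrt{ab}+(1-s)\frac{a+b}{2}$ ($0\le s\le1$). $\cos^{-1}$ is the principal inverse cosine with values in $[0,\pi]$. For symmetric homogeneous means $N_1,N_2$, the relation $N_1\preceq N_2$ means that the function $t\mapsto N_1(e^t,1)/N_2(e^t,1)$ is positive definite on $\mathbb{R}$, where $f:\mathbb{R}\to\mathbb{C}$ is positive definite if the matrix $[f(t_i-t_j)]_{i,j=1,\dots,n}$ is positive semi-definite for all $n\in\mathbb{N}$ and $t_1,\dots,t_n\in\mathbb{R}$. *)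

(* Defs.v *)
From HB Require Import structures.
From mathcomp Require Export all_boot all_order all_algebra.
From mathcomp Require Export sesquilinear spectral.
From mathcomp Require Export complex.
From mathcomp Require Export reals sequences exp trigo.
Import Order.TTheory GRing.Theory Num.Theory.

Set Implicit Arguments.
Unset Strict Implicit.
Unset Printing Implicit Defensive.

Local Open Scope ring_scope.
Local Open Scope sesquilinear_scope.

(* In a [numClosedFieldType], [0 <= z] means that [z] is real and nonnegative,
   so this condition forces [A] to be Hermitian. *)
Definition psdmx (C : numClosedFieldType) (n : nat) (A : 'M[C]_n) : Prop :=
  forall x : 'cV[C]_n, 0 <= (x ^t* *m A *m x) 0 0.

Definition positive_definite (R : realType) (f : R -> R[i]) : Prop :=
  forall (n : nat) (t : 'I_n -> R), psdmx (\matrix_(i, j) f (t i - t j)).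

(* The means are only ever used at positive arguments; outside this range the
   values of [powR] and [Num.sqrt] are junk. *)
Definition heinz_mean (R : realType) (v a b : R) : R :=
  2^-1 * (powR a v * powR b (1 - v) + powR a (1 - v) * powR b v).

Definition heron_mean (R : realType) (s a b : R) : R :=
  s * Num.sqrt (a * b) + (1 - s) * ((a + b) / 2).

(* The relation N1 \preceq N2 between symmetric homogeneous means. *)
Definition mean_preceq (R : realType) (N1 N2 : R -> R -> R) : Prop :=
  positive_definite (fun t : R => (N1 (expR t) 1 / N2 (expR t) 1)%:C%C).

(* Main.v *)
Require Import Defs.
From mathcomp Require Import ring lra.
From mathcomp Require Import boolp classical_sets filter topology normedtype.
Import Order.TTheory GRing.Theory Num.Theory numFieldNormedType.Exports.
Set Implicit Arguments.
Unset Strict Implicit.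
Unset Printing Implicit Defensive.
Local Open Scope classical_set_scope.
Local Open Scope ring_scope.

(** With [x = t / 2] and [a = |2 * v - 1|] the quotient of the two means is
    [cosh (a * x) / (s + (1 - s) * cosh x)].  For [s = 1] it is [cosh (a * x)],
    which is positive definite only when it is bounded, that is for [a = 0].
    For [s < 1] it is, up to a positive factor, [cosh (a * x) / (cosh x + c)]
    with [c = s / (1 - s)]; when [c <= 1] put [c = cos th], [0 <= th <= pi / 2].
    The claim becomes: the function is positive definite if and only if [c <= 1]
    and [a * (pi - th) <= pi / 2].  Geometrically, the zero of [cosh (a * x)]
    on the imaginary axis must not come before the first pole [i (pi - th)].
    For rational [a = m / n] everything is algebraic: in [X = cosh (x / n)] the
    function is the rational function [T_m(X) / (T_n(X) + c)], with [T_n] the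
    Chebyshev polynomials, whose zeros and poles are explicit.

    Sufficiency ([pd_multiplier_heinz]).  Rather than positive definite kernels
    one follows the kernels that multiply positive semi-definite arrays into
    such arrays.  This class is closed under products (that is, composition),
    sums, pointwise limits and, when [|K| < 1], [K |-> 1 / (1 - K)], and it
    contains the kernels [f u * f v]; hence it contains
    [1 / cosh (u - v) = 1 / (cosh u * cosh v * (1 - tanh u * tanh v))], then
    [1 / (cosh w - k)] for [-1 <= k < 1], then
    [(cosh w - l) / (cosh w - k) = 1 + (k - l) / (cosh w - k)] for [l <= k].
    The factorised rational function is a product of such ratios as soon as the
    zeros [cos (...)] of [T_m] lie below the corresponding roots of [T_n + c]
    ([cheb_angle_compare]).  Real [a], and [th = 0], follow by limits.

    Necessity.  If [f] is positive definite so is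
    [2 cosh (l h) f(u) - f(u + h) - f(u - h)], because on [cos (xi * u)] this
    operator acts by the factor [2 cosh (l h) - 2 cos (xi h) >= 0].  Composing
    these operators for [l < k] and evaluating at [0] gives a functional that is
    nonnegative on positive definite functions and kills polynomials in [cosh]
    of degree less than [k]; up to a factor it is a divided difference of [f], as a
    function of [cosh], at the nodes [cosh (l h)], so its value on a rational function of
    [cosh] is explicit.  As [h -> 0] and [k -> oo] the pole of largest real
    value dominates, so its residue is nonnegative ([pd_poles_residue]).  For
    [T_m(X) / (T_n(X) + cos th)] the sign of this residue is that of
    [cos (m / n * (pi - th))], which gives the condition on [a].  When [c > 1]
    one reduces to [a = 0]; with [n = 2] the poles are [+-i tau], and
    nonnegativity for all [k] would keep the powers of [1 + i tau] in the upper
    half plane ([not_pd_imaginary_poles]).  Products with multipliers move the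
    parameters to rational [a] and to [th > 0]. *)

(** * Limits of sequences *)

Section Limits.
Variable R : realType.

Lemma cvg_sum_seq (I : eqType) (rs : seq I) (f : nat -> I -> R) (l : I -> R) :
  (forall z, z \in rs -> f N z @[N --> \oo] --> l z) ->
  \sum_(z <- rs) f N z @[N --> \oo] --> \sum_(z <- rs) l z.
Proof.
move=> fl; rewrite [X in _ --> X]big_seq; under eq_cvg do rewrite big_seq.
apply: (@cvg_big _ _ ( +%R : R -> R -> R)) => //.
exact: add_continuous.
Qed.

Lemma cvg_prod_ord (k : nat) (f : nat -> 'I_k -> R) (l : 'I_k -> R) :
  (forall i, f N i @[N --> \oo] --> l i) ->
  \prod_i f N i @[N --> \oo] --> \prod_i l i.
Proof.
move=> fl; apply: (@cvg_big _ _ ( *%R : R -> R -> R)) => //.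
exact: mul_continuous.
Qed.

Lemma cvgn_continuous (h : R -> R) (f : nat -> R) (l : R) :
  continuous h -> f N @[N --> \oo] --> l -> h (f N) @[N --> \oo] --> h l.
Proof. by move=> hc; exact: (continuous_cvg _ (hc l)). Qed.

Lemma harmonic_gt0 N : 0 < harmonic N :> R.
Proof. by rewrite /harmonic /= invr_gt0 ltr0n. Qed.

End Limits.

(** * Schur multipliers *)

Section Multipliers.
Variable R : realType.

Definition psd_array (n : nat) (A : 'I_n -> 'I_n -> R) : Prop :=
  forall x : 'I_n -> R, 0 <= \sum_i \sum_j x i * x j * A i j.

(** Quantifying over all semi-definite arrays makes stability under products a
    mere composition; applied to the constant array [1] a multiplier is itself a
    positive semi-definite kernel. *)
Definition schur_multiplier (T : Type) (K : T -> T -> R) : Prop :=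
  forall n (t : 'I_n -> T) (A : 'I_n -> 'I_n -> R),
    psd_array A -> psd_array (fun i j => K (t i) (t j) * A i j).

Lemma psd_array_ext n (A B : 'I_n -> 'I_n -> R) :
  psd_array A -> (forall i j, A i j = B i j) -> psd_array B.
Proof.
move=> psdA AB x; under eq_bigr do under eq_bigr do rewrite -AB.
exact: psdA.
Qed.

Lemma schur_multiplier_ext (T : Type) (K K' : T -> T -> R) :
  schur_multiplier K -> (forall u v, K u v = K' u v) -> schur_multiplier K'.
Proof.
move=> mK KK' n t A psdA; apply: (psd_array_ext (mK n t A psdA)) => i j /=.
by rewrite KK'.
Qed.

Lemma schur_multiplier_comp (S T : Type) (phi : S -> T) (K : T -> T -> R) :
  schur_multiplier K -> schur_multiplier (fun u v => K (phi u) (phi v)).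
Proof. by move=> mK n t A; exact: (mK n (phi \o t)). Qed.

(** The factors [phi] are absorbed into the vector of the quadratic form. *)
Lemma schur_multiplier_rank1 (T : Type) (phi : T -> R) :
  schur_multiplier (fun u v => phi u * phi v).
Proof.
move=> n t A psdA x; have := psdA (fun i => phi (t i) * x i).
congr (0 <= _); apply: eq_bigr => i _; apply: eq_bigr => j _; ring.
Qed.

Lemma schur_multiplier_cst (T : Type) (c : R) :
  0 <= c -> schur_multiplier (fun _ _ : T => c).
Proof.
move=> c0; apply: (schur_multiplier_ext
  (@schur_multiplier_rank1 T (fun=> Num.sqrt c))) => _ _.
by rewrite -expr2 sqr_sqrtr.
Qed.

Lemma schur_multiplierD (T : Type) (K L : T -> T -> R) :
  schur_multiplier K -> schur_multiplier L ->
  schur_multiplier (fun u v => K u v + L u v).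
Proof.
move=> mK mL n t A psdA x.
under eq_bigr do under eq_bigr do rewrite mulrDl mulrDr.
under eq_bigr do rewrite big_split.
by rewrite big_split addr_ge0//; [exact: mK | exact: mL].
Qed.

Lemma schur_multiplierM (T : Type) (K L : T -> T -> R) :
  schur_multiplier K -> schur_multiplier L ->
  schur_multiplier (fun u v => K u v * L u v).
Proof.
move=> mK mL n t A psdA.
apply: (psd_array_ext (mK n t _ (mL n t A psdA))) => i j.
by rewrite mulrA.
Qed.

Lemma schur_multiplierX (T : Type) (K : T -> T -> R) k :
  schur_multiplier K -> schur_multiplier (fun u v => K u v ^+ k).
Proof.
move=> mK; elim: k => [|k IHk].
  exact: (schur_multiplier_ext (@schur_multiplier_cst T 1 ler01)).
by apply: (schur_multiplier_ext (schur_multiplierM mK IHk)) => u v;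
  rewrite exprS.
Qed.

Lemma schur_multiplier_sum (T : Type) (K : nat -> T -> T -> R) k :
  (forall i, (i < k)%N -> schur_multiplier (K i)) ->
  schur_multiplier (fun u v => \sum_(i < k) K i u v).
Proof.
elim: k => [|k IHk] mK.
  apply: (schur_multiplier_ext (@schur_multiplier_cst T 0 (lexx 0))) => u v.
  by rewrite big_ord0.
have mk : schur_multiplier (fun u v => \sum_(i < k) K i u v).
  by apply: IHk => i ik; apply: mK; rewrite (ltn_trans ik).
apply: (schur_multiplier_ext (schur_multiplierD mk (mK k (ltnSn k)))) => u v.
by rewrite big_ord_recr.
Qed.

Lemma schur_multiplier_prod (T : Type) (K : nat -> T -> T -> R) k :
  (forall i, (i < k)%N -> schur_multiplier (K i)) ->
  schur_multiplier (fun u v => \prod_(i < k) K i u v).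
Proof.
elim: k => [|k IHk] mK.
  apply: (schur_multiplier_ext (@schur_multiplier_cst T 1 ler01)) => u v.
  by rewrite big_ord0.
have mk : schur_multiplier (fun u v => \prod_(i < k) K i u v).
  by apply: IHk => i ik; apply: mK; rewrite (ltn_trans ik).
apply: (schur_multiplier_ext (schur_multiplierM mk (mK k (ltnSn k)))) => u v.
by rewrite big_ord_recr.
Qed.

Lemma schur_multiplier_lim (T : Type) (K_ : nat -> T -> T -> R) K :
  (forall N, schur_multiplier (K_ N)) ->
  (forall u v, K_ N u v @[N --> \oo] --> K u v) -> schur_multiplier K.
Proof.
move=> mK K_K n t A psdA x.
apply: (@cvgr_to_ge _ (\oo : set_system nat) _ _
  (fun N => \sum_i \sum_j x i * x j * (K_ N (t i) (t j) * A i j))).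
  apply: cvg_sum_seq => i _; apply: cvg_sum_seq => j _.
  by apply: cvgMl_tmp; apply: cvgMr_tmp; exact: K_K.
by apply: nearW => N; exact: mK.
Qed.

Lemma schur_multiplier_geometric (T : Type) (K : T -> T -> R) :
  (forall u v, `|K u v| < 1) -> schur_multiplier K ->
  schur_multiplier (fun u v => (1 - K u v)^-1).
Proof.
move=> K1 mK.
apply: (@schur_multiplier_lim _ (fun N u v => \sum_(i < N) K u v ^+ i)).
  by move=> N; apply: (schur_multiplier_sum (K := fun i u v => K u v ^+ i)) => i _;
    exact: schur_multiplierX.
move=> u v; rewrite -[_^-1]mul1r.
have -> : (fun N => \sum_(i < N) K u v ^+ i) = series (geometric 1 (K u v)).
  apply/funext => N; rewrite /series /= big_mkord.
  by apply: eq_bigr => i _; rewrite mul1r.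
exact: cvg_geometric_series.
Qed.

End Multipliers.

(** * Multipliers built from the hyperbolic cosine *)

Section HyperbolicMultipliers.
Variable R : realType.
Implicit Types x y k l : R.

Definition cosh x := (expR x + expR (- x)) / 2.
Definition sinh x := (expR x - expR (- x)) / 2.

Lemma cosh0 : cosh 0 = 1.
Proof. by rewrite /cosh oppr0 expR0; lra. Qed.

Lemma coshN x : cosh (- x) = cosh x.
Proof. by rewrite /cosh opprK addrC. Qed.

Lemma sinhN x : sinh (- x) = - sinh x.
Proof. by rewrite /sinh opprK -mulNr opprB. Qed.

Lemma coshD x y : cosh (x + y) = cosh x * cosh y + sinh x * sinh y.
Proof. by rewrite /cosh /sinh opprD !expRD; field. Qed.

Lemma coshB x y : cosh (x - y) = cosh x * cosh y - sinh x * sinh y.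
Proof. by rewrite coshD coshN sinhN mulrN. Qed.

Lemma cosh2_sinh2 x : cosh x ^+ 2 - sinh x ^+ 2 = 1.
Proof. by rewrite !expr2 -coshB subrr cosh0. Qed.

Lemma cosh_double x : cosh (x + x) = 2 * cosh x ^+ 2 - 1.
Proof. by rewrite coshD -!expr2 -[X in _ - X](cosh2_sinh2 x); ring. Qed.

Lemma coshDB x y : cosh (x + y) + cosh (x - y) = 2 * cosh x * cosh y.
Proof. by rewrite coshB coshD; ring. Qed.

Lemma cosh_gt0 x : 0 < cosh x.
Proof. by rewrite divr_gt0// addr_gt0 ?expR_gt0. Qed.

Lemma cosh_ge1 x : 1 <= cosh x.
Proof.
have := sqr_ge0 (sinh x); have := cosh2_sinh2 x; have := cosh_gt0 x.
by move=> *; nra.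
Qed.

Lemma ltr_cosh x y : 0 <= x -> x < y -> cosh x < cosh y.
Proof.
move=> x0 xy; pose p := (x + y) / 2; pose d := (y - x) / 2.
have -> : cosh x = cosh (p - d) by congr cosh; rewrite /p /d; field.
have -> : cosh y = cosh (p + d) by congr cosh; rewrite /p /d; field.
have sinh_gt0 z : 0 < z -> 0 < sinh z.
  by move=> z0; rewrite divr_gt0// subr_gt0 ltr_expR; lra.
rewrite coshB coshD ltrD2l; apply: (@lt_trans _ _ 0).
  by rewrite oppr_lt0 mulr_gt0// sinh_gt0 /p /d; lra.
by rewrite mulr_gt0// sinh_gt0 /p /d; lra.
Qed.

Lemma cosh_gt1 x : 0 < x -> 1 < cosh x.
Proof. by move=> x0; rewrite -[X in X < _]cosh0 ltr_cosh. Qed.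

Lemma continuous_cosh : continuous cosh.
Proof.
move=> x; apply: cvgMr_tmp; apply: cvgD; first exact: continuous_expR.
apply: (continuous_comp (f := -%R)); first exact: opp_continuous.
exact: continuous_expR.
Qed.

(** The translation-invariant multipliers, seen as functions of [u - v]. *)
Definition pd_multiplier (f : R -> R) := schur_multiplier (fun u v => f (u - v)).

Lemma pd_multiplier_cst k : 0 <= k -> pd_multiplier (fun=> k).
Proof. exact: schur_multiplier_cst. Qed.

Lemma pd_multiplier_scale f l :
  pd_multiplier f -> pd_multiplier (fun u => f (l * u)).
Proof.
move=> mf; apply: (schur_multiplier_ext (schur_multiplier_comp ( *%R l) mf)).
by move=> u v; rewrite mulrBr.
Qed.

(** From [cosh (u - v) = cosh u * cosh v * (1 - tanh u * tanh v)], a rank-one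
    kernel times a geometric series in a rank-one kernel. *)
Lemma pd_multiplier_sech : pd_multiplier (fun u => (cosh u)^-1).
Proof.
pose th u := sinh u / cosh u.
have th1 u : `|th u| < 1.
  rewrite normf_div ltr_pdivrMr ?normr_gt0 ?gt_eqF ?cosh_gt0// mul1r.
  by rewrite -ltr_sqr ?nnegrE// !real_normK ?num_real// -subr_gt0 cosh2_sinh2.
have thM u v : `|th u * th v| < 1.
  by rewrite normrM; have := th1 u; have := th1 v; have := normr_ge0 (th u);
    have := normr_ge0 (th v); move=> *; nra.
apply: (schur_multiplier_ext (schur_multiplierM
  (schur_multiplier_rank1 (fun u => (cosh u)^-1))
  (schur_multiplier_geometric thM (schur_multiplier_rank1 th)))) => u v.
rewrite -!invfM coshB; congr (_^-1).
have := cosh_gt0 u; have := cosh_gt0 v; rewrite /th => cv cu.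
by field; rewrite !gt_eqF.
Qed.

(** Since [cosh w - k = 2 * (C ^+ 2 - (1 + k) / 2)] with [C = cosh (w / 2)], the
    inverse is a geometric series with nonnegative coefficients in [C^-1 ^+ 2].
    Halving the argument is what allows negative [k]. *)
Lemma pd_multiplier_pole k : -1 <= k < 1 ->
  pd_multiplier (fun u => (cosh u - k)^-1).
Proof.
move=> /andP[k1 k2].
pose S u := ((cosh (2^-1 * u))^-1) ^+ 2.
have mS : pd_multiplier S.
  exact: (schur_multiplierX 2 (pd_multiplier_scale 2^-1 pd_multiplier_sech)).
have S01 u : 0 < S u <= 1.
  have h := cosh_ge1 (2^-1 * u).
  rewrite exprn_gt0 ?invr_gt0 ?cosh_gt0//= exprn_ile1 ?invr_ge0 ?(ltW (cosh_gt0 _))//.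
  by rewrite invf_le1 ?cosh_gt0.
have kS u v : `|(1 + k) / 2 * S (u - v)| < 1.
  by have /andP[*] := S01 (u - v); rewrite ger0_norm; nra.
have k0 : 0 <= (1 + k) / 2 by lra.
have h0 : 0 <= (2^-1 : R) by lra.
apply: (schur_multiplier_ext (schur_multiplierM
   (schur_multiplierM (pd_multiplier_cst h0) mS)
   (schur_multiplier_geometric kS
      (schur_multiplierM (pd_multiplier_cst k0) mS)))) => u v /=.
have -> : u - v = 2^-1 * (u - v) + 2^-1 * (u - v) by field.
rewrite cosh_double /S -mulrDr.
have -> : 2^-1 * (u - v + (u - v)) = u - v by field.
have := cosh_ge1 (2^-1 * (u - v)); set C := cosh _ => C1.
have C0 : C != 0 by rewrite gt_eqF//; lra.
have D0 : 2 * C ^+ 2 - 1 - k != 0 by rewrite gt_eqF//; nra.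
have D1 : 1 - (1 + k) / 2 * C^-1 ^+ 2 != 0.
  by rewrite gt_eqF// subr_gt0 (le_lt_trans (ler_norm _))// kS.
by field; rewrite C0 D0.
Qed.

Lemma pd_multiplier_ratio l k : -1 <= k < 1 -> l <= k ->
  pd_multiplier (fun u => (cosh u - l) / (cosh u - k)).
Proof.
move=> k1 lk; have kl : 0 <= k - l by lra.
apply: (schur_multiplier_ext (schur_multiplierD
  (pd_multiplier_cst ler01)
  (schur_multiplierM (pd_multiplier_cst kl)
    (pd_multiplier_pole k1)))) => u v /=.
have D0 : cosh (u - v) - k != 0.
  by rewrite gt_eqF//; have := cosh_ge1 (u - v); lra.
by field.
Qed.

End HyperbolicMultipliers.

(** * Chebyshev polynomials and rational exponents *)

Section Chebyshev.
Variable R : realType.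
Implicit Types (x u th : R) (n m k : nat).

Lemma ltr_cos_itv x u : 0 <= x -> x < u -> u <= pi -> cos u < cos x.
Proof.
by move=> x0 xu upi; rewrite ltr_cos// in_itv/= ?x0 ?(le_trans (ltW xu))//
  (le_trans x0 (ltW xu)).
Qed.

Lemma ler_cos_itv x u : 0 <= x -> x <= u -> u <= pi -> cos u <= cos x.
Proof.
by rewrite [x <= u]le_eqVlt => x0 /predU1P[->//|xu upi]; rewrite ltW// ltr_cos_itv.
Qed.

Fixpoint cheb n : {poly R} :=
  if n is m.+1 then
    if m is k.+1 then 2 *: ('X * cheb m) - cheb k else 'X
  else 1.

Lemma chebSS n : cheb n.+2 = 2 *: ('X * cheb n.+1) - cheb n.
Proof. by []. Qed.

Lemma size_cheb n : (size (cheb n) <= n.+1)%N.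
Proof.
suff: (size (cheb n) <= n.+1)%N && (size (cheb n.+1) <= n.+2)%N by case/andP.
elim: n => [|n /andP[IH0 IH1]]; first by rewrite /= size_poly1 size_polyX.
rewrite IH1 chebSS; apply: (leq_trans (size_polyD _ _)).
rewrite size_polyN geq_max (leq_trans IH0) ?andbT; last by rewrite ltnW.
apply: (leq_trans (size_scale_leq _ _)); apply: (leq_trans (size_polyMleq _ _)).
by rewrite size_polyX.
Qed.

Lemma horner_cheb x (c : nat -> R) :
  c 0%N = 1 -> c 1%N = x -> (forall n, c n.+2 = 2 * x * c n.+1 - c n) ->
  forall n, (cheb n).[x] = c n.
Proof.
move=> c0 c1 cS n.
suff: (cheb n).[x] = c n /\ (cheb n.+1).[x] = c n.+1 by case.
elim: n => [|n [IH0 IH1]]; first by rewrite /= hornerC hornerX c0 c1.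
split=> //; by rewrite cS -IH1 -IH0 chebSS !hornerE.
Qed.

Lemma cheb_cosh n u : (cheb n).[cosh u] = cosh (n%:R * u).
Proof.
apply: (horner_cheb (c := fun n => cosh (n%:R * u))).
- by rewrite mul0r cosh0.
- by rewrite mul1r.
move=> k; have := coshDB (k.+1%:R * u) u.
have -> : k.+1%:R * u + u = k.+2%:R * u by rewrite -(natr1 k.+1); ring.
have -> : k.+1%:R * u - u = k%:R * u by rewrite -(natr1 k); ring.
by move=> h; lra.
Qed.

Lemma cheb_cos n u : (cheb n).[cos u] = cos (n%:R * u).
Proof.
apply: (horner_cheb (c := fun n => cos (n%:R * u))).
- by rewrite mul0r cos0.
- by rewrite mul1r.
move=> k; have hD := cosD (k.+1%:R * u) u; have hB := cosB (k.+1%:R * u) u.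
have e1 : k.+1%:R * u + u = k.+2%:R * u by rewrite -(natr1 k.+1); ring.
have e2 : k.+1%:R * u - u = k%:R * u by rewrite -(natr1 k); ring.
rewrite e1 in hD; rewrite e2 in hB; rewrite hD hB; ring.
Qed.

Lemma cheb1 n : (cheb n).[1] = 1.
Proof. by rewrite -(@cosh0 R) cheb_cosh mulr0. Qed.

(** For [0 < th < pi], the positive solutions [y] of [cos y = - cos th] in
    increasing order: [pi - th], [pi + th], [3 pi - th], [3 pi + th] and so on;
    the roots of [T_n + cos th] are the [cos (y / n)] for the first [n] of them.
    For [th = pi / 2] these are the zeros of [cos], which treats [T_m] as well. *)
Definition cheb_angle th k : R :=
  if odd k then k%:R * pi + th else k.+1%:R * pi - th.

Lemma cos_natpiD k x : cos (k%:R * pi + x) = (-1) ^+ k * cos x.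
Proof.
elim: k => [|k IHk]; first by rewrite mul0r add0r mul1r.
rewrite -natr1 mulrDl mul1r addrAC cosDpi IHk exprS; ring.
Qed.

Lemma cos_cheb_angle th k : cos (cheb_angle th k) = - cos th.
Proof.
rewrite /cheb_angle; case: ifP => ok; rewrite cos_natpiD ?cosN -signr_odd /= ok;
  by rewrite /= ?expr0 ?expr1 ?mulN1r.
Qed.

Lemma cheb_angle_lt th k : 0 < th < pi ->
  cheb_angle th k < cheb_angle th k.+1.
Proof.
move=> /andP[th0 thpi]; rewrite /cheb_angle /=; case: (odd k) => /=.
  by rewrite -(natr1 k.+1) -(natr1 k) !mulrDl; lra.
by lra.
Qed.

Lemma cheb_angle_homo th : 0 < th < pi ->
  {homo cheb_angle th : k m / (k < m)%N >-> k < m}.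
Proof.
move=> thpi; apply: homo_ltn => [y x z|k]; first exact: lt_trans.
exact: cheb_angle_lt.
Qed.

Lemma cheb_angle_itv th n k : 0 < th < pi -> (k < n)%N ->
  0 < cheb_angle th k < n%:R * pi.
Proof.
move=> /andP[th0 thpi] kn; have kn' : k.+1%:R <= n%:R :> R by rewrite ler_nat.
have k0 : 0 <= k%:R * pi :> R by rewrite mulr_ge0// pi_ge0.
have nk : k.+1%:R * pi <= n%:R * pi :> R by rewrite ler_pM2r// pi_gt0.
move: nk; rewrite /cheb_angle -natr1 mulrDl mul1r.
by case: ifP => _ nk; apply/andP; split; lra.
Qed.

Lemma cheb_root_angle_itv th n k : 0 < th < pi -> (k < n)%N ->
  0 < cheb_angle th k / n%:R < pi.
Proof.
move=> thpi kn; have /andP[h1 h2] := cheb_angle_itv thpi kn.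
have n0 : 0 < n%:R :> R by rewrite ltr0n (leq_ltn_trans _ kn).
by rewrite divr_gt0//= ltr_pdivrMr// mulrC.
Qed.

Lemma cheb_root_lt1 th n k : 0 < th < pi -> (k < n)%N ->
  -1 <= cos (cheb_angle th k / n%:R) < 1.
Proof.
move=> thpi kn; have /andP[h1 h2] := cheb_root_angle_itv thpi kn.
by rewrite cos_geN1 -[X in _ < X](@cos0 R) ltr_cos_itv// ltW.
Qed.

Definition cheb_roots th n := [seq cos (cheb_angle th k / n%:R) | k <- iota 0 n].

Lemma uniq_cheb_roots th n : 0 < th < pi -> uniq (cheb_roots th n).
Proof.
move=> thpi; rewrite map_inj_in_uniq ?iota_uniq// => j k.
rewrite !mem_iota !add0n /= => jn kn ejk.
have n0 : n%:R != 0 :> R by rewrite pnatr_eq0 -lt0n (leq_ltn_trans _ jn).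
have /andP[j1 j2] := cheb_root_angle_itv thpi jn.
have /andP[k1 k2] := cheb_root_angle_itv thpi kn.
move/cos_inj: ejk; rewrite !in_itv/= !ltW// => /(_ isT isT).
move=> /(congr1 ( *%R^~ n%:R)); rewrite !divfK// => ejk.
case: (ltngtP j k) => [jk|kj|//].
  by have := cheb_angle_homo thpi jk; rewrite ejk ltxx.
by have := cheb_angle_homo thpi kj; rewrite ejk ltxx.
Qed.

(** The [n] listed roots are distinct, so they exhaust the degree.  The leading
    coefficient is positive because the value at [1] is [1 + cos th] and all
    roots are below [1]. *)
Lemma cheb_factor th n : 0 < th < pi ->
  exists2 L, 0 < L & forall x, (cheb n).[x] + cos th =
    L * \prod_(k < n) (x - cos (cheb_angle th k / n%:R)).
Proof.
move=> thpi; have /andP[th0 thp] := thpi.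
pose p := cheb n + (cos th)%:P.
have pE x : p.[x] = (cheb n).[x] + cos th by rewrite /p hornerD hornerC.
have p1 : 0 < p.[1].
  have := ltr_cos_itv (ltW th0) thp (lexx _).
  by rewrite cospi pE cheb1; lra.
have p0 : p != 0 by apply: contraL p1 => /eqP ->; rewrite horner0 ltxx.
have rootp : all (root p) (cheb_roots th n).
  apply/allP => _ /mapP[k + ->]; rewrite mem_iota add0n /= => kn.
  have n0 : n%:R != 0 :> R by rewrite pnatr_eq0 -lt0n (leq_ltn_trans _ kn).
  by rewrite rootE pE cheb_cos mulrC divfK// cos_cheb_angle addNr.
have szr : size (cheb_roots th n) = n by rewrite size_map size_iota.
have szp : size p = (size (cheb_roots th n)).+1.
  apply/eqP; rewrite eqn_leq (max_poly_roots p0 rootp (uniq_cheb_roots n thpi)).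
  rewrite andbT szr (leq_trans (size_polyD _ _))// geq_max size_cheb.
  by rewrite (leq_trans (size_polyC_leq1 _)).
have urs : uniq_roots (cheb_roots th n) by rewrite uniq_rootsE uniq_cheb_roots.
have pF x : p.[x] =
    lead_coef p * \prod_(k < n) (x - cos (cheb_angle th k / n%:R)).
  rewrite {1}(all_roots_prod_XsubC szp rootp urs) hornerZ horner_prod.
  congr (_ * _); rewrite big_map -[in iota 0 n](subn0 n) -/(index_iota 0 n) big_mkord.
  by apply: eq_bigr => k _; rewrite !hornerE.
exists (lead_coef p) => [|x]; last by rewrite -pE pF.
move: p1; rewrite pF pmulr_lgt0//; apply: prodr_gt0 => k _.
by rewrite subr_gt0; have /andP[] := cheb_root_lt1 thpi (ltn_ord k).
Qed.

(** The [k]-th zero of the numerator comes after the [k]-th pole.  For even [k]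
    this reduces to the hypothesis [m (pi - th) <= n pi / 2], the case [k = 0];
    for odd [k] it follows from [m <= n] and [th <= pi / 2]. *)
Lemma cheb_angle_compare th (n m k : nat) : th <= pi / 2 ->
  m%:R * (pi - th) <= n%:R * (pi / 2) -> (m <= n)%N -> (k < m)%N ->
  cheb_angle th k / n%:R <= cheb_angle (pi / 2) k / m%:R.
Proof.
move=> th2 mth mn km.
have m0 : 0 < m%:R :> R by rewrite ltr0n (leq_ltn_trans _ km).
have n0 : 0 < n%:R :> R by rewrite ltr0n (leq_trans (leq_ltn_trans _ km) mn).
have mn' : m%:R <= n%:R :> R by rewrite ler_nat.
rewrite ler_pdivrMr// mulrAC ler_pdivlMr// /cheb_angle.
have kpi : 0 <= k%:R * pi :> R by rewrite mulr_ge0// pi_ge0.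
have pi0 := pi_gt0 R.
case: ifP => _; last by rewrite -natr1; nra.
apply: (@le_trans _ _ ((k%:R * pi + pi / 2) * m%:R)); first by nra.
by rewrite ler_pM2l//; lra.
Qed.

Lemma pd_multiplier_heinz_rat th (n m : nat) : 0 < th <= pi / 2 ->
  m%:R * (pi - th) <= n%:R * (pi / 2) -> (m <= n)%N ->
  pd_multiplier (fun u => cosh (m%:R * u) / (cosh (n%:R * u) + cos th)).
Proof.
move=> /andP[th0 th2] mth mn; have pi0 := pi_gt0 R.
have thpi : 0 < th < pi by rewrite th0 /=; lra.
have pi2 : 0 < (pi / 2 : R) < pi by apply/andP; split; lra.
have [L L0 LE] := cheb_factor n thpi.
have [M M0 ME] := cheb_factor m pi2.
pose al k : R := cos (cheb_angle (pi / 2) k / m%:R).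
pose be k : R := cos (cheb_angle th k / n%:R).
(* The poles of index [k >= m] have no zero to be paired with. *)
pose r k u := (if (k < m)%N then cosh u - al k else 1) / (cosh u - be k).
have mr k : (k < n)%N -> pd_multiplier (r k).
  move=> kn; have bek := cheb_root_lt1 thpi kn.
  rewrite /r; case: ltnP => [km|mk].
    apply: pd_multiplier_ratio => //; rewrite /al /be.
    have /andP[h1 h2] := cheb_root_angle_itv thpi kn.
    have /andP[h3 h4] := cheb_root_angle_itv pi2 km.
    by rewrite ler_cos_itv ?(cheb_angle_compare th2 mth mn km)// ltW.
  apply: (schur_multiplier_ext (pd_multiplier_pole bek)) => u v.
  by rewrite div1r.
have mprod : pd_multiplier (fun u => \prod_(i < n) r i u).
  exact: (schur_multiplier_prod (K := fun i u v => r i (u - v)) mr).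
have LM0 : 0 <= M / L by rewrite divr_ge0// ltW.
apply: (schur_multiplier_ext (schur_multiplierM
  (pd_multiplier_cst LM0) mprod)) => u v /=.
rewrite -!cheb_cosh LE -[(cheb m).[_]]addr0 -(cos_pihalf R) ME.
rewrite /r big_split prodfV /= -big_mkcond.
by rewrite -(big_ord_widen _ (fun k => _ - al k))//= invfM mulrACA.
Qed.

End Chebyshev.

(** * Sufficiency for real exponents *)

Section RealExponent.
Variable R : realType.
Implicit Types (a th u : R).

(** The rational exponents [trunc (a (N + 1)) / (N + 1)] approach [a] from below,
    so that the hypotheses on [a] pass to them. *)
Lemma pd_multiplier_heinz_gt0 a th : 0 <= a <= 1 -> 0 < th <= pi / 2 ->
  a * (pi - th) <= pi / 2 ->
  pd_multiplier (fun u => cosh (a * u) / (cosh u + cos th)).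
Proof.
move=> /andP[a0 a1] th02 ath; have /andP[th0 th2] := th02.
have pi0 := pi_gt0 R.
pose m N := Num.truncn (a * N.+1%:R).
have N0 N : 0 < N.+1%:R :> R by rewrite ltr0n.
have mle N : (m N)%:R <= a * N.+1%:R.
  by have /truncn_itv/andP[] : 0 <= a * N.+1%:R by rewrite mulr_ge0.
have mge N : a * N.+1%:R <= (m N)%:R + 1.
  rewrite natr1 ltW//.
  by have /truncn_itv/andP[] : 0 <= a * N.+1%:R by rewrite mulr_ge0.
pose r N := (m N)%:R / N.+1%:R : R.
have ra : r N @[N --> \oo] --> a.
  apply: (@squeeze_cvgr _ _ _ _ (fun N => a - harmonic N) (fun=> a)).
  - apply: nearW => N; rewrite /r /harmonic /= ler_pdivrMr// mle andbT.
    by rewrite ler_pdivlMr// mulrBl mulVf ?gt_eqF// lerBlDr mge.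
  - rewrite -[X in _ --> X]subr0; apply: cvgB; first exact: cvg_cst.
    exact: cvg_harmonic.
  - exact: cvg_cst.
apply: (@schur_multiplier_lim _ _ (fun N u v =>
    cosh (r N * (u - v)) / (cosh (u - v) + cos th))) => [N|u v]; last first.
  apply: cvgMr_tmp.
  apply: (@cvgn_continuous _ _ (fun N => r N * (u - v)) _ (@continuous_cosh R)).
  exact: cvgMr_tmp.
have mN : (m N <= N.+1)%N.
  by rewrite -(ler_nat R) (le_trans (mle N))// ler_piMl// ltW.
have mth : (m N)%:R * (pi - th) <= N.+1%:R * (pi / 2).
  apply: (@le_trans _ _ (a * N.+1%:R * (pi - th))).
    by rewrite ler_wpM2r//; lra.
  by rewrite mulrAC mulrC ler_pM2l.
apply: (schur_multiplier_ext (pd_multiplier_scale N.+1%:R^-1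
   (pd_multiplier_heinz_rat th02 mth mN))) => u v.
by rewrite /r mulrA mulVKf ?gt_eqF.
Qed.

(** At [th = 0] the roots of [T_n + cos th] are double and the factorisation is
    lost; the limit [th -> 0] recovers this case, where [a <= 1 / 2] makes
    the condition hold for all positive [th]. *)
Lemma pd_multiplier_heinz a th : 0 <= a <= 1 -> 0 <= th <= pi / 2 ->
  a * (pi - th) <= pi / 2 ->
  pd_multiplier (fun u => cosh (a * u) / (cosh u + cos th)).
Proof.
move=> a01 /andP[]; rewrite le_eqVlt => /predU1P[<-|th0 th2]; last first.
  by apply: pd_multiplier_heinz_gt0; rewrite // th0.
rewrite subr0 => _ api; have pi0 := pi_gt0 R; have /andP[a0 a1] := a01.
pose tN N := pi / 2 * harmonic N : R.
have tN0 N : 0 < tN N by rewrite mulr_gt0// ?divr_gt0// invr_gt0 ltr0n.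
have tNcvg : tN N @[N --> \oo] --> 0.
  by rewrite -(mulr0 (pi / 2)); apply: cvgMl_tmp; exact: cvg_harmonic.
apply: (@schur_multiplier_lim _ _ (fun N u v =>
    cosh (a * (u - v)) / (cosh (u - v) + cos (tN N)))) => [N|u v]; last first.
  apply: cvgMl_tmp; apply: cvgV.
    by rewrite cos0 gt_eqF// addr_gt0// cosh_gt0.
  apply: cvgD; first exact: cvg_cst.
  exact: (cvgn_continuous (@continuous_cos R) tNcvg).
apply: pd_multiplier_heinz_gt0 => //.
  rewrite tN0 /tN ler_piMr//; first by rewrite divr_ge0// ltW.
  by rewrite /harmonic/= invf_le1// ler1n.
by have := tN0 N; nra.
Qed.

End RealExponent.

(** * Real and complex positive definiteness *)

Section ComplexForm.
Variable R : realType.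

Lemma conjC_conjc (z : R[i]) : z^* = conjc z.
Proof. by []. Qed.

Definition pd (f : R -> R) : Prop :=
  forall n (t : 'I_n -> R), psd_array (fun i j => f (t i - t j)).

(** For a real symmetric array the complex quadratic form at [p + i q] is the sum
    of the real forms at [p] and [q]; the cross terms cancel by evenness. *)
Lemma pd_positive_definite (f : R -> R) : (forall x, f (- x) = f x) ->
  positive_definite (fun t => (f t)%:C%C) <-> pd f.
Proof.
move=> fN.
have formE n (t : 'I_n -> R) (x : 'cV[R[i]]_n) :
    ((x ^t* *m (\matrix_(i, j) (f (t i - t j))%:C%C) *m x) 0 0)%sesqui =
    \sum_i \sum_j (x i 0)^* * x j 0 * (f (t i - t j))%:C%C.
  rewrite mxE exchange_big; apply: eq_bigr => j _; rewrite mxE mulr_suml.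
  by apply: eq_bigr => i _; rewrite !mxE mulrAC.
split=> pdf n t x.
  have := pdf n t (\col_i (x i)%:C%C); rewrite formE.
  under eq_bigr do under eq_bigr do
    rewrite !mxE conjC_conjc conjc_real -!rmorphM.
  under eq_bigr do rewrite -rmorph_sum.
  by rewrite -rmorph_sum ler0c.
pose p i := complex.Re (x i 0); pose q i := complex.Im (x i 0).
have xE i : x i 0 = (p i +i* q i)%C by rewrite /p /q; case: (x i 0).
have asym : \sum_i \sum_j (p i * q j - q i * p j) * f (t i - t j) = 0.
  have -> : \sum_i \sum_j (p i * q j - q i * p j) * f (t i - t j) =
      \sum_i \sum_j p i * q j * f (t i - t j) -
      \sum_i \sum_j q i * p j * f (t i - t j).
    rewrite -sumrB; apply: eq_bigr => i _; rewrite -sumrB.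
    by apply: eq_bigr => j _; rewrite mulrBl.
  rewrite [X in _ - X]exchange_big; apply/eqP; rewrite subr_eq0; apply/eqP.
  apply: eq_bigr => i _; apply: eq_bigr => j _.
  by rewrite (mulrC (q j)) -fN opprB.
have sym : 0 <= \sum_i \sum_j (p i * p j + q i * q j) * f (t i - t j).
  under eq_bigr do under eq_bigr do rewrite mulrDl.
  under eq_bigr do rewrite big_split.
  by rewrite big_split addr_ge0//; exact: pdf.
rewrite formE.
suff -> : \sum_i \sum_j (x i 0)^* * x j 0 * (f (t i - t j))%:C%C =
    (\sum_i \sum_j (p i * p j + q i * q j) * f (t i - t j))%:C%C +
    'i%C * (\sum_i \sum_j (p i * q j - q i * p j) * f (t i - t j))%:C%C.
  by rewrite asym mulr0 addr0 ler0c.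
rewrite !rmorph_sum mulr_sumr -big_split; apply: eq_bigr => i _.
rewrite !rmorph_sum mulr_sumr -big_split; apply: eq_bigr => j _ /=.
by rewrite conjC_conjc !xE; simpc; congr (_ +i* _)%C; ring.
Qed.

End ComplexForm.

(** * A difference functional nonnegative on positive definite functions *)

Section DifferenceFunctional.
Variable R : realType.
Implicit Types (h u v c : R) (f g : R -> R) (k l n : nat).

Lemma pd_multiplier_pd f g : pd_multiplier f -> pd g -> pd (fun u => f u * g u).
Proof. by move=> mf pg n t; exact: (mf n t _ (pg n t)). Qed.

Lemma pd_scale f (l : R) : pd f -> pd (fun u => f (l * u)).
Proof.
move=> pf n t; apply: (psd_array_ext (pf n (fun i => l * t i))) => i j.
by rewrite mulrBr.
Qed.

Lemma pd_ge0 f : pd f -> 0 <= f 0.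
Proof.
move=> /(_ 1%N (fun=> 0) (fun=> 1)).
by rewrite !big_ord1 !mul1r subrr.
Qed.

Definition shift_op h l f u :=
  2 * cosh (l%:R * h) * f u - f (u + h) - f (u - h).

(** [2 f(u) - f(u + h) - f(u - h)] comes from the quadratic form of [f] on the
    points [t i] and [t i + h] with opposite weights; the rest is a nonnegative
    multiple of [f]. *)
Lemma pd_shift_op h l f : pd f -> pd (shift_op h l f).
Proof.
move=> pf n t x.
pose t2 (i : 'I_(n + n)) :=
  match split i with inl j => t j | inr j => t j + h end.
pose x2 (i : 'I_(n + n)) :=
  match split i with inl j => x j | inr j => - x j end.
have := pf _ t2 x2; have := pf n t x => p1 p2.
have C1 : 0 <= 2 * (cosh (l%:R * h) - 1) by have := cosh_ge1 (l%:R * h); lra.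
have := addr_ge0 (mulr_ge0 C1 p1) p2; congr (0 <= _).
have spl i : split (lshift n i) = inl i by exact: (unsplitK (inl i)).
have spr i : split (rshift n i) = inr i by exact: (unsplitK (inr i)).
rewrite big_split_ord /= -big_split mulr_sumr -big_split /=.
apply: eq_bigr => i _; rewrite !big_split_ord /= -!big_split mulr_sumr -big_split /=.
apply: eq_bigr => j _; rewrite /t2 /x2 !spl !spr /shift_op.
rewrite (_ : t i - (t j + h) = t i - t j - h); last by ring.
rewrite (_ : t i + h - t j = t i - t j + h); last by ring.
rewrite (_ : t i + h - (t j + h) = t i - t j); last by ring.
by ring.
Qed.

Fixpoint diff_functional h k f : R :=
  if k is j.+1 then diff_functional h j (shift_op h j f) else f 0.
Local Notation lam := diff_functional.

Lemma pd_diff_functional h k f : pd f -> 0 <= lam h k f.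
Proof.
elim: k f => [|k IHk] f pf; first exact: pd_ge0.
by apply: IHk; exact: pd_shift_op.
Qed.

Lemma eq_diff_functional h k f g : f =1 g -> lam h k f = lam h k g.
Proof. by move=> /funext ->. Qed.

Lemma diff_functional_linear h k (a b : R) f g :
  lam h k (fun u => a * f u + b * g u) = a * lam h k f + b * lam h k g.
Proof.
elim: k f g => [//|k IHk] f g /=; rewrite -IHk.
by apply: eq_diff_functional => u; rewrite /shift_op; ring.
Qed.

Lemma diff_functionalZ h k (a : R) f :
  lam h k (fun u => a * f u) = a * lam h k f.
Proof.
rewrite -[RHS]addr0 -[X in _ + X](mul0r (lam h k f)) -diff_functional_linear.
by apply: eq_diff_functional => u; ring.
Qed.

Lemma diff_functionalD h k f g :
  lam h k (fun u => f u + g u) = lam h k f + lam h k g.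
Proof.
rewrite -[lam h k f]mul1r -[lam h k g]mul1r -diff_functional_linear.
by apply: eq_diff_functional => u; ring.
Qed.

Lemma diff_functional_sum h k (I : Type) (r : seq I) (F : I -> R -> R) :
  lam h k (fun u => \sum_(i <- r) F i u) = \sum_(i <- r) lam h k (F i).
Proof.
elim: r => [|i r IHr].
  rewrite big_nil -[RHS](mul0r (lam h k (fun=> 0))) -diff_functionalZ.
  by apply: eq_diff_functional => u; rewrite big_nil mul0r.
rewrite big_cons -IHr -diff_functionalD.
by apply: eq_diff_functional => u; rewrite big_cons.
Qed.

(** [cosh (j u)] is an eigenfunction of each shift operator, with eigenvalue [0]
    for the operator of index [j]. *)
Lemma diff_functional_cosh h k j : (j < k)%N ->
  lam h k (fun u => cosh (j%:R * u)) = 0.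
Proof.
elim: k => [//|k IHk]; rewrite ltnS => jk /=.
rewrite (@eq_diff_functional h k _ (fun u =>
  (2 * cosh (k%:R * h) - 2 * cosh (j%:R * h)) * cosh (j%:R * u))).
  rewrite diff_functionalZ; move: jk; rewrite leq_eqVlt => /predU1P[->|jk].
    by rewrite subrr mul0r.
  by rewrite IHk// mulr0.
move=> u; rewrite /shift_op mulrDr mulrBr.
have := coshDB (j%:R * u) (j%:R * h); lra.
Qed.

Lemma diff_functional_cosh_monomial h k i j : (i + j < k)%N ->
  lam h k (fun u => cosh u ^+ i * cosh (j%:R * u)) = 0.
Proof.
elim: i j => [|i IHi] j ijk.
  rewrite -[RHS](diff_functional_cosh h ijk).
  by apply: eq_diff_functional => u; rewrite mul1r.
case: j ijk => [|j] ijk.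
  rewrite -[RHS](IHi 1%N); last by move: ijk; rewrite addn0 addn1.
  by apply: eq_diff_functional => u; rewrite mul0r cosh0 mulr1 mul1r exprSr.
have h1 := IHi j.+2; have h2 := IHi j.
rewrite (@eq_diff_functional h k _ (fun u =>
   2^-1 * (cosh u ^+ i * cosh (j.+2%:R * u)) +
   2^-1 * (cosh u ^+ i * cosh (j%:R * u)))).
  rewrite diff_functional_linear h1; last by move: ijk; rewrite !addnS addSn.
  rewrite h2 ?mulr0 ?addr0//; apply: leq_ltn_trans ijk.
  by rewrite leq_add// leqnSn.
move=> u; have := coshDB (j.+1%:R * u) u.
have -> : j.+1%:R * u + u = j.+2%:R * u by rewrite -(natr1 j.+1); ring.
have -> : j.+1%:R * u - u = j%:R * u by rewrite -(natr1 j); ring.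
by rewrite exprSr -mulrDr addrC -mulrDr addrC => ->; field.
Qed.

End DifferenceFunctional.

(** * The difference functional on rational functions of cosh *)

Section NodeEvaluation.
Variable R : realType.
Implicit Types (h u v c : R) (f g : R -> R) (k l n : nat) (p q : {poly R}).
Local Notation lam := diff_functional.

Lemma diff_functional_poly h k p : (size p <= k)%N ->
  lam h k (fun u => p.[cosh u]) = 0.
Proof.
move=> pk; rewrite (@eq_diff_functional _ _ _ _ (fun u =>
  \sum_(i < size p) p`_i * (cosh u ^+ i * cosh (0%:R * u)))).
  rewrite diff_functional_sum big1// => i _.
  rewrite diff_functionalZ diff_functional_cosh_monomial ?mulr0// addn0.
  exact: leq_trans pk.
by move=> u; rewrite horner_coef; apply: eq_bigr => i _;
  rewrite mul0r cosh0 mulr1.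
Qed.

(** The functional only reads [f] at the points [l h], [|l| <= k + 1], and the
    two extreme ones enter with coefficient [(-1) ^+ k.+1]. *)
Lemma diff_functional_nodes h k f :
  (forall j, (j <= k)%N -> f (j%:R * h) = 0 /\ f (- (j%:R * h)) = 0) ->
  lam h k.+1 f = (-1) ^+ k.+1 * (f (k.+1%:R * h) + f (- (k.+1%:R * h))).
Proof.
elim: k f => [|k IHk] f f0.
  have [f00 _] := f0 0%N isT; rewrite mul0r in f00.
  by rewrite /= /shift_op f00 mul1r add0r sub0r; ring.
have shD j : j%:R * h + h = j.+1%:R * h by rewrite -(natr1 j); ring.
have shB j : j.+1%:R * h - h = j%:R * h by rewrite -(natr1 j); ring.
have shDN j : - (j.+1%:R * h) + h = - (j%:R * h) by rewrite -(natr1 j); ring.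
have shBN j : - (j%:R * h) - h = - (j.+1%:R * h) by rewrite -(natr1 j); ring.
rewrite -[LHS]/(lam h k.+1 (shift_op h k.+1 f)) IHk => [|j jk].
  rewrite /shift_op shD shB shDN shBN.
  have [-> ->] := f0 k (leqnSn k); have [-> ->] := f0 k.+1 (leqnn _).
  by rewrite [in RHS]exprS; ring.
rewrite /shift_op shD shBN.
have [-> ->] := f0 j (leqW jk).
have [-> ->] := f0 j.+1 jk.
case: j jk => [|j] jk.
  have [f1 f2] := f0 1%N isT; rewrite mul1r in f1 f2.
  by rewrite mul0r oppr0 !add0r f1 f2; split; ring.
have [e1 e2] := f0 j (leqW (ltnW jk)).
by rewrite shB shDN e1 e2; split; ring.
Qed.

Definition node_poly h k : {poly R} :=
  \prod_(l < k) ('X - (cosh (l%:R * h))%:P).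

Lemma node_polyS h k :
  node_poly h k.+1 = node_poly h k * ('X - (cosh (k%:R * h))%:P).
Proof. by rewrite /node_poly big_ord_recr. Qed.

Lemma node_poly0 h k j : (j < k)%N -> (node_poly h k).[cosh (j%:R * h)] = 0.
Proof.
move=> jk; rewrite horner_prod (bigD1 (Ordinal jk))//=.
by rewrite !hornerE subrr mul0r.
Qed.

Lemma node_poly_gt0 h k : 0 < h -> 0 < (node_poly h k).[cosh (k%:R * h)].
Proof.
move=> h0; rewrite horner_prod; apply: prodr_gt0 => i _.
rewrite !hornerE subr_gt0 ltr_cosh//; first by rewrite mulr_ge0 ?ler0n ?ltW.
by rewrite ltr_pM2r// ltr_nat.
Qed.

Lemma size_node_poly h k : size (node_poly h k) = k.+1.
Proof.
by rewrite /node_poly size_prod_XsubC -[index_enum _]enumT -cardE card_ord.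
Qed.

(** Multiplying [1 / Q] by the node polynomial leaves only the last node; modulo
    a polynomial of low degree, which the functional kills, this product is the
    constant [c] times [1 / Q].  The cofactor [P] makes the remainder constant
    when [Q] is not linear. *)
Lemma diff_functional_quotient h k (P Q S : {poly R}) c :
  (forall u, Q.[cosh u] != 0) -> (size S <= k.+1)%N ->
  node_poly h k.+1 * P = S * Q + c%:P ->
  c * lam h k.+1 (fun u => (Q.[cosh u])^-1) =
  (-1) ^+ k.+1 * (2 * (node_poly h k.+1).[cosh (k.+1%:R * h)] *
     P.[cosh (k.+1%:R * h)] / Q.[cosh (k.+1%:R * h)]).
Proof.
move=> Q0 Sk e.
pose f u := (node_poly h k.+1).[cosh u] * P.[cosh u] / Q.[cosh u].
have fE u : f u = S.[cosh u] + c * (Q.[cosh u])^-1.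
  by rewrite /f -hornerM e !hornerE; field.
transitivity (lam h k.+1 f).
  rewrite (eq_diff_functional _ _ fE) diff_functionalD diff_functional_poly//.
  by rewrite add0r diff_functionalZ.
have fN u : f (- u) = f u by rewrite /f coshN.
rewrite diff_functional_nodes => [|j jk].
  by rewrite fN /f; congr (_ * _); ring.
by rewrite fN /f node_poly0 ?ltnS// !mul0r.
Qed.

Lemma diff_functional_pole h k c : c < 1 ->
  lam h k.+1 (fun u => (cosh u - c)^-1) =
  2 * (node_poly h k.+1).[cosh (k.+1%:R * h)] *
    \prod_(l < k.+2) (cosh (l%:R * h) - c)^-1.
Proof.
move=> c1; set W := node_poly h k.+1.
have Xc u : cosh u - c != 0 by rewrite subr_eq0 gt_eqF// (lt_le_trans c1) ?cosh_ge1.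
have QE u : ('X - c%:P).[cosh u] = cosh u - c by rewrite !hornerE.
have [S eS] : exists S, W - (W.[c])%:P = S * ('X - c%:P).
  by apply/factor_theorem; rewrite rootE !hornerE subrr.
have W0 : W - (W.[c])%:P != 0.
  rewrite -size_poly_gt0 size_polyDl ?size_node_poly// size_polyN.
  by rewrite (leq_ltn_trans (size_polyC_leq1 _)).
have sS : size S = k.+1.
  have := congr1 (fun p : {poly R} => size p) eS.
  rewrite size_Mmonic ?monicXsubC//; last first.
    by apply: contra_neq W0 => S0; rewrite eS S0 mul0r.
  rewrite size_XsubC addn2 /= size_polyDl ?size_node_poly => [[->]//|].
  by rewrite size_polyN (leq_ltn_trans (size_polyC_leq1 _)).
have e : W * 1 = S * ('X - c%:P) + (W.[c])%:P by rewrite -eS mulr1 subrK.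
have Q0 u : ('X - c%:P).[cosh u] != 0 by rewrite QE.
have := diff_functional_quotient Q0 (eq_leq sS) e.
under eq_diff_functional do rewrite QE.
have -> : W.[c] = (-1) ^+ k.+1 * \prod_(l < k.+1) (cosh (l%:R * h) - c).
  rewrite /W horner_prod.
  rewrite (eq_bigr (fun l : 'I__ => -1 * (cosh (l%:R * h) - c))) => [|i _].
    by rewrite big_split /= prodr_const card_ord.
  by rewrite !hornerE mulN1r opprB.
rewrite -!mulrA QE hornerC mul1r => /(mulfI (negbT (signr_eq0 R k.+1))).
have P0 : \prod_(l < k.+1) (cosh (l%:R * h) - c) != 0.
  by apply/prodf_neq0 => i _.
move=> /(canRL (mulKf P0)) ->.
by rewrite prodfV [in RHS]big_ord_recr /= -/W invfM; ring.
Qed.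

End NodeEvaluation.

(** * Real poles: sign of the dominant residue *)

Section RealPoles.
Variable R : realType.
Implicit Types (h u v c : R) (f g : R -> R) (k l n : nat) (rho : R -> R).

Lemma cvg_cosh_harmonic l : cosh (l%:R * harmonic N) @[N --> \oo] --> (1 : R).
Proof.
have h0 : l%:R * harmonic N @[N --> \oo] --> (0 : R).
  by rewrite -(mulr0 l%:R); apply: cvgMl_tmp; exact: cvg_harmonic.
rewrite -[X in _ --> X](@cosh0 R); exact: (cvgn_continuous (@continuous_cosh R) h0).
Qed.

(** The limit [h -> 0] of the difference functional: up to a positive factor, the
    coefficients of the expansion of the rational function in powers of
    [1 - cosh u] are nonnegative. *)
Lemma pd_poles_coef rho (rs : seq R) k : (forall z, z \in rs -> z < 1) ->
  pd (fun u => \sum_(z <- rs) rho z / (cosh u - z)) ->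
  0 <= \sum_(z <- rs) rho z * (1 - z)^-1 ^+ k.+2.
Proof.
move=> rs1 pf.
have coef_ge0 N : 0 <= \sum_(z <- rs)
    rho z * \prod_(l < k.+2) (cosh (l%:R * harmonic N) - z)^-1.
  have h0 := harmonic_gt0 R N.
  have := pd_diff_functional (harmonic N) k.+1 pf.
  rewrite diff_functional_sum big_seq.
  under eq_bigr => z zrs do
    rewrite diff_functionalZ diff_functional_pole ?rs1// mulrCA.
  rewrite -big_seq -mulr_sumr pmulr_rge0// mulr_gt0//; exact: node_poly_gt0.
apply: (cvgr_to_ge (F := \oo) _ (nearW _ coef_ge0)).
apply: cvg_sum_seq => z zrs; apply: cvgMl_tmp.
have -> : (1 - z)^-1 ^+ k.+2 = \prod_(l < k.+2) (1 - z)^-1.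
  by rewrite prodr_const card_ord.
apply: cvg_prod_ord => l.
apply: cvgV; first by rewrite subr_eq0 gt_eqF ?rs1.
by apply: cvgB; [exact: cvg_cosh_harmonic | exact: cvg_cst].
Qed.

(** After division by [(1 - b)^-1 ^+ k.+2] the contributions of the other poles
    tend to [0] with [k], because [1 - b] is the smallest of the [1 - z]. *)
Lemma pd_poles_residue rho (a b : R) (rs : seq R) : b < 1 ->
  (forall z, z \in rs -> z < b) ->
  pd (fun u => a / (cosh u - b) + \sum_(z <- rs) rho z / (cosh u - z)) ->
  0 <= a.
Proof.
move=> b1 rsb pf.
pose rho' z := if z == b then a else rho z.
have rhoE z : z \in rs -> rho' z = rho z.
  by move=> zrs; rewrite /rho' lt_eqF ?rsb.
have pf' : pd (fun u => \sum_(z <- b :: rs) rho' z / (cosh u - z)).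
  congr pd: pf; apply/funext => u; rewrite big_cons /rho' eqxx; congr (_ + _).
  by apply: eq_big_seq => z zrs; rewrite -/(rho' z) rhoE.
have rs1 z : z \in b :: rs -> z < 1.
  by rewrite inE => /predU1P[->//|/rsb zb]; exact: lt_trans b1.
have B0 : 0 < 1 - b by rewrite subr_gt0.
have coef_ge0 k : 0 <= a + \sum_(z <- rs) rho z * ((1 - b) / (1 - z)) ^+ k.+2.
  have := pd_poles_coef k rs1 pf'.
  rewrite big_cons {1}/rho' eqxx => h.
  have := mulr_ge0 (exprn_ge0 k.+2 (ltW B0)) h.
  rewrite mulrDr mulrCA -exprMn mulfV ?gt_eqF// expr1n mulr1 mulr_sumr.
  rewrite big_seq [X in _ -> 0 <= a + X]big_seq.
  congr (_ <= _ + _); apply: eq_bigr => z zrs.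
  by rewrite rhoE// mulrCA -exprMn.
apply: (cvgr_to_ge (F := \oo) _ (nearW _ coef_ge0)).
rewrite -[X in _ --> X]addr0; apply: cvgD; first exact: cvg_cst.
have z0 : \sum_(z <- rs) rho z * 0 = 0 by rewrite big1// => z _; rewrite mulr0.
rewrite -[X in _ --> X]z0; apply: cvg_sum_seq => z zrs.
have zb := rsb z zrs; have z1 : 0 < 1 - z by lra.
apply: cvgMl_tmp.
have ratio : `|(1 - b) / (1 - z)| < 1.
  by rewrite ger0_norm ?divr_ge0 ?ltW// ltr_pdivrMr//; lra.
by have := cvg_expr ratio; rewrite -cvg_shiftS -cvg_shiftS.
Qed.



(** The coefficient at the head [b] is explicit because, for the dominant pole,
    its sign is what decides.  Subtracting it leaves a numerator divisible by
    ['X - b%:P], hence the induction on the remaining roots. *)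
Lemma partial_fractions (rs : seq R) (b : R) (p : {poly R}) :
  uniq (b :: rs) -> (size p <= (size rs).+1)%N ->
  exists rho, forall x, x \notin b :: rs ->
    p.[x] / \prod_(z <- b :: rs) (x - z) =
    (p.[b] / \prod_(z <- rs) (b - z)) / (x - b) +
    \sum_(z <- rs) rho z / (x - z).
Proof.
elim: rs b p => [|c rs IHrs] b p.
  move=> _ /size1_polyC ->; exists (fun=> 0) => x _.
  by rewrite big_cons !big_nil addr0 !hornerC mulr1 divr1.
set A := p.[b] / \prod_(z <- c :: rs) (b - z).
rewrite [uniq _]/= => /andP[bcrs ucrs] sp.
have prod_neq0 x : x \notin c :: rs -> \prod_(z <- c :: rs) (x - z) != 0.
  move=> xcrs; rewrite prodf_seq_neq0; apply/allP => z zcrs /=.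
  by rewrite subr_eq0; apply: contraNneq xcrs => ->.
pose Q : {poly R} := \prod_(z <- c :: rs) ('X - z%:P).
have QE x : Q.[x] = \prod_(z <- c :: rs) (x - z).
  by rewrite horner_prod; apply: eq_bigr => z _; rewrite !hornerE.
have [p' p'E] : exists p', p - A *: Q = p' * ('X - b%:P).
  apply/factor_theorem; rewrite rootE !hornerE QE /A divfK ?subrr//.
  exact: prod_neq0.
have sp' : (size p' <= (size rs).+1)%N.
  have [->|p'0] := eqVneq p' 0; first by rewrite size_poly0.
  have := size_Mmonic p'0 (monicXsubC b).
  rewrite -p'E size_XsubC addn2 /= -ltnS => <-.
  rewrite (leq_trans (size_polyD _ _))// geq_max sp size_polyN.
  by rewrite (leq_trans (size_scale_leq _ _))// size_prod_XsubC.
have [rho rhoE] := IHrs c p' ucrs sp'.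
pose A' := p'.[c] / \prod_(z <- rs) (c - z).
exists (fun z => if z == c then A' else rho z) => x.
rewrite in_cons negb_or => /andP[xb xcrs].
have -> : p.[x] = A * \prod_(z <- c :: rs) (x - z) + p'.[x] * (x - b).
  by rewrite -QE -hornerZ -[x - b]hornerXsubC -hornerM -p'E -hornerD subrKC.
have xb0 : x - b != 0 by rewrite subr_eq0.
have P0 := prod_neq0 x xcrs; have := rhoE x xcrs.
move: P0; set P := \prod_(z <- c :: rs) _ => P0 rE.
rewrite [\prod_(z <- b :: _) _]big_cons -/P.
have -> : (A * P + p'.[x] * (x - b)) / ((x - b) * P) = A / (x - b) + p'.[x] / P.
  by field; rewrite P0.
rewrite rE big_cons eqxx; congr (_ + (_ + _)).
apply: eq_big_seq => z zrs; case: eqVneq => // zc.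
by move: ucrs; rewrite /= -zc zrs.
Qed.

(** The largest root of [T_n + cos th] is [cos ((pi - th) / n)], where [T_m] takes
    the value [cos (m (pi - th) / n)]; the residue there has the same sign. *)
Lemma pd_heinz_rat_necessary (th : R) n m : 0 < th <= pi / 2 -> (m < n)%N ->
  pd (fun u => cosh (m%:R * u) / (cosh (n%:R * u) + cos th)) ->
  0 <= cos (m%:R * (pi - th) / n%:R).
Proof.
move=> /andP[th0 th2] mn pf.
have thpi : 0 < th < pi by have := pi_gt0 R; lra.
have [L L0 LE] := cheb_factor n thpi.
case: n mn pf L L0 LE => [//|n] mn pf L L0 LE.
pose be k : R := cos (cheb_angle th k / n.+1%:R).
pose rs := [seq be k | k <- iota 1 n].
have rootsE : cheb_roots th n.+1 = be 0%N :: rs by [].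
have urs : uniq (be 0%N :: rs) by rewrite -rootsE uniq_cheb_roots.
have rs_lt z : z \in rs -> z < be 0%N.
  move=> /mapP[k]; rewrite mem_iota add1n => /andP[k0 kn] ->.
  have /andP[a0 _] := cheb_root_angle_itv thpi (ltn0Sn n).
  have /andP[_ a1] := cheb_root_angle_itv thpi kn.
  rewrite ltr_cos_itv ?ltW// ltr_pM2r ?invr_gt0 ?ltr0n//.
  exact: cheb_angle_homo.
have /andP[_ be1] := cheb_root_lt1 thpi (ltn0Sn n).
have sp : (size (L^-1 *: cheb R m) <= (size rs).+1)%N.
  rewrite size_map size_iota (leq_trans (size_scale_leq _ _))//.
  exact: leq_trans (size_cheb _ _) _.
have [rho rhoE] := partial_fractions urs sp.
have prodE x : \prod_(k < n.+1) (x - be k) = \prod_(z <- be 0%N :: rs) (x - z).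
  by rewrite -rootsE big_map -[in iota 0 _](subn0 n.+1) -/(index_iota 0 _) big_mkord.
have pf' : pd (fun u =>
    ((L^-1 *: cheb R m).[be 0%N] / \prod_(z <- rs) (be 0%N - z)) /
    (cosh u - be 0%N) + \sum_(z <- rs) rho z / (cosh u - z)).
  congr pd: pf; apply/funext => u; rewrite -rhoE; last first.
    apply/negP; rewrite inE => /predU1P[ub|/rs_lt ub].
      by have := cosh_ge1 u; rewrite ub leNgt be1.
    by have := lt_trans ub be1; rewrite ltNge cosh_ge1.
  rewrite -!cheb_cosh LE -/be prodE hornerZ invfM mulrCA mulrA.
  by rewrite mulrAC.
have := pd_poles_residue be1 rs_lt pf'.
rewrite pmulr_lge0; last first.
  rewrite invr_gt0 big_seq; apply: prodr_gt0 => z /rs_lt.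
  by rewrite subr_gt0.
rewrite hornerZ pmulr_rge0 ?invr_gt0// cheb_cos /cheb_angle /= mul1r.
by rewrite mulrA.
Qed.

End RealPoles.

(** * Conjugate imaginary poles *)

Section ImaginaryPoles.
Variable R : realType.
Implicit Types (h u c q : R) (k l n : nat).

(** If [q = tau ^+ 2] and [pole_power q X k = (a, d)], then [a + i tau d] is the
    product of the [X l + i tau] for [l < k]. *)
Fixpoint pole_power (q : R) (X : nat -> R) k : R * R :=
  if k is j.+1 then
    let: (a, d) := pole_power q X j in (a * X j - q * d, d * X j + a)
  else (1, 0).

(** At the root [X = i tau] of [X ^+ 2 + q] the node polynomial is, up to the sign
    [(-1) ^+ k.+1], the conjugate [a - i tau d] of the product that [pole_power]
    computes. *)
Lemma node_poly_modulo h q k :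
  let: (a, d) := pole_power q (fun l => cosh (l%:R * h)) k.+1 in
  exists2 S : {poly R}, (size S <= k)%N &
  node_poly h k.+1 = S * ('X^2 + q%:P) +
    ((-1) ^+ k.+1)%:P * (a%:P - d%:P * 'X).
Proof.
elim: k => [|k IHk].
  exists 0; rewrite ?size_poly0// /node_poly big_ord1.
  by rewrite mul0r cosh0 !mul1r mulr0 subr0 mul0r !add0r expr1 polyCN; ring.
move: IHk; rewrite [pole_power _ _ k.+2]/= -/(pole_power _ _ k.+1).
case: pole_power => a d [S sS SE].
rewrite node_polyS SE; set C := cosh (k.+1%:R * h).
exists (S * ('X - C%:P) - ((-1) ^+ k.+1 * d)%:P).
  rewrite (leq_trans (size_polyD _ _))// geq_max size_polyN.
  rewrite (leq_trans (size_polyC_leq1 _))// andbT.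
  by rewrite (leq_trans (size_polyMleq _ _))// size_XsubC addn2.
rewrite [_ ^+ k.+2]exprS; set e : R := (-1) ^+ k.+1.
by rewrite !(polyCM, polyCB, polyCD, polyCN); ring.
Qed.

(** The powers [a k + i tau d k] of [1 + i tau], [q = tau ^+ 2], wind around the
    origin.  If all [d k] are nonnegative then [a] is nonincreasing; it cannot
    become negative, or [d] would decrease linearly; hence [d] is nondecreasing
    and at least [1], and [a] decreases linearly, which is absurd. *)
Lemma no_nonneg_spiral q (a d : nat -> R) : 0 < q ->
  d 0%N = 0 -> a 0%N = 1 ->
  (forall k, d k.+1 = d k + a k) -> (forall k, a k.+1 = a k - q * d k) ->
  ~ (forall k, 0 <= d k).
Proof.
move=> q0 d0 a0 dS aS d_ge0.
have a_le k j : a (k + j)%N <= a k.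
  elim: j => [|j IHj]; first by rewrite addn0.
  by rewrite addnS aS (le_trans _ IHj)// gerBl mulr_ge0// ltW.
have a_ge0 k : 0 <= a k.
  rewrite leNgt; apply/negP => ak.
  have dk j : d (k + j)%N <= d k + j%:R * a k.
    elim: j => [|j IHj]; first by rewrite addn0 mul0r addr0.
    by rewrite addnS dS -natr1 mulrDl mul1r addrA lerD.
  have := archi_boundP (divr_ge0 (d_ge0 k) (ltW (_ : 0 < - a k))).
  rewrite oppr_gt0 => /(_ ak); set N := Num.bound _.
  rewrite ltr_pdivrMr ?oppr_gt0// => h.
  by have := d_ge0 (k + N)%N; have := dk N; lra.
have d_ge1 k : 1 <= d k.+1.
  elim: k => [|k IHk]; first by rewrite dS d0 a0 add0r.
  by rewrite dS (le_trans IHk)// lerDl.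
have a_up j : a j.+1 <= a 1%N - j%:R * q.
  elim: j => [|j IHj]; first by rewrite mul0r subr0.
  rewrite aS -natr1; have := d_ge1 j; nra.
have := archi_boundP (divr_ge0 (a_ge0 1%N) (ltW q0)); set N := Num.bound _.
rewrite ltr_pdivrMr// => h.
by have := a_ge0 N.+1; have := a_up N; lra.
Qed.

Lemma not_pd_imaginary_poles q : 0 < q ->
  ~ pd (fun u => (cosh u ^+ 2 + q)^-1).
Proof.
move=> q0 pf.
pose pw h := pole_power q (fun l => cosh (l%:R * h)).
pose pw1 := pole_power q (fun=> 1).
have pwS h k : pw h k.+1 = ((pw h k).1 * cosh (k%:R * h) - q * (pw h k).2,
                            (pw h k).2 * cosh (k%:R * h) + (pw h k).1).
  by rewrite /pw /=; case: pole_power.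
have pw1S k : pw1 k.+1 = ((pw1 k).1 - q * (pw1 k).2, (pw1 k).2 + (pw1 k).1).
  by rewrite /pw1 /=; case: pole_power => a d; rewrite !mulr1.
have pw_ge0 h k : 0 < h -> 0 <= (pw h k).2.
  move=> h0; case: k => [//|[|k]]; first by rewrite pwS /= mul0r add0r ler01.
  have := node_poly_modulo h q k; rewrite pwS -/(pw h k.+1).
  case: (pw h k.+1) => a d [S sS SE]; rewrite [(_, _).1]/= [(_, _).2]/=.
  set e : R := (-1) ^+ k.+1 in SE.
  have e2 : e * e = 1 by rewrite /e -expr2 sqrr_sign.
  have QE u : ('X^2 + q%:P : {poly R}).[cosh u] = cosh u ^+ 2 + q by rewrite !hornerE.
  have Q_gt0 u : 0 < ('X^2 + q%:P : {poly R}).[cosh u].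
    by rewrite QE ltr_wpDl ?sqr_ge0.
  (* [P] is the conjugate of the remainder of the node polynomial, so that the
     product of the two is constant modulo the denominator. *)
  pose P : {poly R} := (e * a)%:P + (e * d)%:P * 'X.
  pose S' : {poly R} := S * P - (d ^+ 2)%:P.
  have sP : (size P <= 2)%N.
    rewrite /P (leq_trans (size_polyD _ _))// geq_max.
    rewrite (leq_trans (size_polyC_leq1 _))//=.
    rewrite (leq_trans (size_polyMleq _ _))// size_polyX addn2 /=.
    by rewrite ltnS size_polyC_leq1.
  have sS' : (size S' <= k.+1)%N.
    rewrite /S' (leq_trans (size_polyD _ _))// geq_max size_polyN.
    rewrite (leq_trans (size_polyC_leq1 _))// andbT.
    rewrite (leq_trans (size_polyMleq _ _))//.
    by have := leq_add sS sP; rewrite addn2; case: (_ + _)%N.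
  have E : node_poly h k.+1 * P = S' * ('X^2 + q%:P) + (a ^+ 2 + d ^+ 2 * q)%:P.
    have e2P : e%:P * e%:P = 1 :> {poly R} by rewrite -polyCM e2.
    rewrite SE /S' /P !polyCD !polyCM. ring: e2P.
  have := diff_functional_quotient (fun u => lt0r_neq0 (Q_gt0 u)) sS' E.
  have := pd_diff_functional h k.+1 pf.
  under eq_diff_functional do rewrite -QE.
  set Lam := diff_functional _ _ _ => Lam0 LamE.
  have : 0 <= (a ^+ 2 + d ^+ 2 * q) * Lam.
    by rewrite mulr_ge0// addr_ge0 ?sqr_ge0// mulr_ge0 ?sqr_ge0// ltW.
  rewrite LamE mulrA pmulr_lge0 ?invr_gt0//.
  rewrite mulrCA pmulr_rge0; last by rewrite mulr_gt0// node_poly_gt0.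
  rewrite /P !hornerE -/e mulrDr !mulrA e2 !mul1r.
  by rewrite addrC.
have pw_cvg k : (pw (harmonic N) k).1 @[N --> \oo] --> (pw1 k).1 /\
                (pw (harmonic N) k).2 @[N --> \oo] --> (pw1 k).2.
  elim: k => [|k [IH1 IH2]]; first by split; exact: cvg_cst.
  rewrite pw1S /=; split.
    under eq_cvg do rewrite pwS /=.
    apply: cvgB; last exact: cvgMl_tmp.
    by rewrite -[X in _ --> X]mulr1; apply: cvgM => //; exact: cvg_cosh_harmonic.
  under eq_cvg do rewrite pwS /=.
  apply: cvgD => //; rewrite -[X in _ --> X]mulr1.
  by apply: cvgM => //; exact: cvg_cosh_harmonic.
apply: (@no_nonneg_spiral q (fun k => (pw1 k).1) (fun k => (pw1 k).2)) => // [k|k|k].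
- by rewrite pw1S.
- by rewrite pw1S.
have [_ h] := pw_cvg k.
by apply: (cvgr_to_ge (F := \oo) h); apply: nearW => N; exact/pw_ge0/harmonic_gt0.
Qed.

End ImaginaryPoles.

(** * The quotient of the two means *)

Section HeinzHeronRatio.
Variable R : realType.
Implicit Types (a c s v t u th : R) (f : R -> R).

Lemma pd_cst1 : pd (fun=> 1 : R).
Proof.
move=> n t x; suff -> : \sum_i \sum_j x i * x j * 1 = (\sum_i x i) ^+ 2.
  exact: sqr_ge0.
rewrite expr2 mulr_suml; apply: eq_bigr => i _.
by rewrite mulr_sumr; apply: eq_bigr => j _; rewrite mulr1.
Qed.

Lemma pd_multiplierW f : pd_multiplier f -> pd f.
Proof.
move=> /pd_multiplier_pd/(_ pd_cst1) pf.
by congr pd: pf; apply/funext => u; rewrite mulr1.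
Qed.

(** This is the case [c = 0] of the sufficiency result, rescaled by [a]. *)
Lemma pd_multiplier_cosh_ratio (a b : R) : 0 <= b <= a ->
  pd_multiplier (fun u => cosh (b * u) / cosh (a * u)).
Proof.
move=> /andP[b0 ba]; have [a0|a0] := eqVneq a 0.
  have -> : b = 0 by lra.
  apply: (schur_multiplier_ext (pd_multiplier_cst ler01)) => u v.
  by rewrite a0 !mul0r cosh0 divr1.
have {}a0 : 0 < a by rewrite lt_def a0 (le_trans b0).
have pi0 := pi_gt0 R.
have r01 : 0 <= b / a <= 1 by rewrite divr_ge0 ?b0 ?(ltW a0)//= ler_pdivrMr// mul1r.
have th : 0 <= (pi / 2 : R) <= pi / 2 by rewrite lexx divr_ge0// ltW.
have rth : b / a * (pi - pi / 2) <= pi / 2 by have /andP[*] := r01; nra.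
apply: (schur_multiplier_ext (pd_multiplier_scale a
  (pd_multiplier_heinz r01 th rth))) => u v.
by rewrite cos_pihalf addr0 mulrA divfK// gt_eqF.
Qed.

(** Doubling the argument turns [cosh u + c] into
    [2 * (cosh u ^+ 2 + (c - 1) / 2)], whose roots in [cosh u] are imaginary. *)
Lemma not_pd_sech_shift c : 1 < c -> ~ pd (fun u => (cosh u + c)^-1).
Proof.
move=> c1 pf; apply: (@not_pd_imaginary_poles R ((c - 1) / 2)); first by lra.
have two0 : 0 <= 2 :> R by [].
have := pd_multiplier_pd (pd_multiplier_cst two0) (pd_scale 2 pf).
congr pd; apply/funext => u.
have -> : 2 * u = u + u by ring.
rewrite cosh_double; have := sqr_ge0 (cosh u) => C0.
by field; rewrite gt_eqF//; lra.
Qed.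

Lemma rat_between_scaled (b a : R) : 0 <= b < a ->
  exists m n : nat, [/\ (0 < n)%N, b * n%:R < m%:R & m%:R < a * n%:R].
Proof.
move=> /andP[b0 ba]; have ab : 0 < a - b by lra.
have ab1 : 0 <= (a - b)^-1 by rewrite invr_ge0 ltW.
have := archi_boundP ab1; set n := Num.bound _ => nab.
have n0 : 0 < n%:R :> R by exact: le_lt_trans nab.
exists (Num.truncn (b * n%:R)).+1, n; rewrite -(ltr0n R) n0.
have /truncn_itv/andP[h1 h2] : 0 <= b * n%:R by rewrite mulr_ge0// ltW.
split=> //; rewrite -natr1.
have : 1 < (a - b) * n%:R by rewrite mulrC -ltr_pdivrMr// div1r.
lra.
Qed.

(** If [a] were too large, a rational [m / n < a] would violate the bound as well;
    multiplying by [cosh (m / n * u) / cosh (a * u)] replaces [a] by [m / n]. *)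
Lemma pd_heinz_gt0_necessary a th : 0 <= a <= 1 -> 0 < th <= pi / 2 ->
  pd (fun u => cosh (a * u) / (cosh u + cos th)) -> a * (pi - th) <= pi / 2.
Proof.
move=> /andP[a0 a1] th02 pf; have /andP[th0 th2] := th02.
have pi0 := pi_gt0 R; have pth : 0 < pi - th by lra.
rewrite leNgt; apply/negP => ath.
have b0 : 0 <= (pi / 2 / (pi - th) : R) < a.
  apply/andP; split; last by rewrite ltr_pdivrMr.
  by apply: divr_ge0; lra.
have [m [n [n0 bm ma]]] := rat_between_scaled b0.
have n0R : 0 < n%:R :> R by rewrite ltr0n.
have mn : (m < n)%N by rewrite -(ltr_nat R) (lt_le_trans ma)// ler_piMl// ltW.
have ra : 0 <= (m%:R / n%:R : R) <= a.
  apply/andP; split; last by rewrite ler_pdivrMr// ltW.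
  by apply: divr_ge0; rewrite ler0n.
have := pd_multiplier_pd (pd_multiplier_cosh_ratio ra) pf.
move=> /(@pd_scale R _ n%:R) pf'.
have : 0 <= cos (m%:R * (pi - th) / n%:R).
  apply: pd_heinz_rat_necessary => //.
  congr pd: pf'; apply/funext => u.
  have -> : m%:R / n%:R * (n%:R * u) = m%:R * u by rewrite mulrA divfK ?gt_eqF.
  by rewrite mulrA divfK// gt_eqF// cosh_gt0.
apply/negP; rewrite -ltNge -(cos_pihalf R) ltr_cos_itv//.
- by rewrite divr_ge0// ltW.
- rewrite ltr_pdivlMr//; move: bm; rewrite mulrAC ltr_pdivrMr//.
- rewrite ler_pdivrMr//; have : m%:R <= n%:R :> R by rewrite ler_nat ltnW.
  have : 0 <= m%:R :> R by []. nra.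
Qed.

(** Increasing [th] preserves positive definiteness, by a multiplier
    [(cosh u + cos th) / (cosh u + cos x)]; this gives the bound for [x > th] up to
    [pi / 2], and for [th] because a violation at [th] would persist
    slightly above it. *)
Lemma pd_heinz_necessary a th : 0 <= a <= 1 -> 0 <= th <= pi / 2 ->
  pd (fun u => cosh (a * u) / (cosh u + cos th)) -> a * (pi - th) <= pi / 2.
Proof.
move=> a01 /andP[th0 th2] pf; have /andP[a0 a1] := a01.
have pi0 := pi_gt0 R.
have thlt x : th < x -> x <= pi / 2 -> a * (pi - x) <= pi / 2.
  move=> thx x2; have x0 : 0 < x <= pi / 2 by rewrite (le_lt_trans th0).
  apply: pd_heinz_gt0_necessary => //.
  have cx : cos x < cos th by rewrite ltr_cos_itv//; lra.
  have cx0 : 0 <= cos x by rewrite -(cos_pihalf R) ler_cos_itv//; lra.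
  have cx1 := cos_le1 th.
  have k1 : -1 <= - cos x < 1 by lra.
  have lk : - cos th <= - cos x by lra.
  have := pd_multiplier_pd (pd_multiplier_ratio k1 lk) pf.
  congr pd; apply/funext => u; rewrite !opprK.
  rewrite mulrC mulrA divfK// gt_eqF//; have := cosh_ge1 u; lra.
rewrite leNgt; apply/negP => ath.
(* As [a <= 1], moving [th] by half the excess [a (pi - th) - pi / 2] stays
   below [pi / 2] and keeps part of the excess. *)
have th2' : th < pi / 2 by nra.
have e0 : 0 < (a * (pi - th) - pi / 2) / 2 by lra.
set e := _ / 2 in e0.
have := thlt (th + e); rewrite ltrDl => /(_ e0) h.
have : th + e <= pi / 2 by rewrite /e; nra.
move=> /h; rewrite /e; nra.
Qed.

(** For [c > 1] the factor [1 / cosh (a * u)] removes the numerator, which reduces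
    the claim to [a = 0]. *)
Lemma pd_heinz_iff a c : 0 <= a <= 1 -> 0 <= c ->
  pd (fun u => cosh (a * u) / (cosh u + c)) <->
  c <= 1 /\ a * (pi - acos c) <= pi / 2.
Proof.
move=> a01 c0; have /andP[a0 a1] := a01.
have acosE : c <= 1 -> cos (acos c) = c /\ 0 <= acos c <= pi / 2.
  move=> c1; have c11 : -1 <= c <= 1 by lra.
  have cE : cos (acos c) = c by rewrite acosK// in_itv.
  split=> //; rewrite acos_ge0//= leNgt; apply/negP => h.
  have pi0 := pi_gt0 R.
  have : cos (acos c) < cos (pi / 2).
    by rewrite ltr_cos_itv ?acos_lepi//; lra.
  by rewrite cE cos_pihalf ltNge c0.
split=> [pf|[c1 ac]]; last first.
  have [cE th] := acosE c1; apply: pd_multiplierW.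
  by have := pd_multiplier_heinz a01 th ac; rewrite cE.
have [c1|c1] := leP c 1.
  have [cE th] := acosE c1; split=> //.
  by apply: pd_heinz_necessary; rewrite // cE.
exfalso; apply: (not_pd_sech_shift c1).
have m := pd_multiplier_scale a (@pd_multiplier_sech R).
congr pd: (pd_multiplier_pd m pf); apply/funext => u.
by rewrite mulKf// gt_eqF// cosh_gt0.
Qed.

Lemma heinz_heron_ratio s v t :
  heinz_mean v (expR t) 1 / heron_mean s (expR t) 1 =
  cosh (`|2 * v - 1| * (2^-1 * t)) / (s + (1 - s) * cosh (2^-1 * t)).
Proof.
rewrite /heinz_mean /heron_mean !powR1 -!expRM !mulr1.
set w := 2^-1 * t.
have tE : t = w + w by rewrite /w; field.
have sq : Num.sqrt (expR t) = expR w.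
  by rewrite tE expRD -expr2 sqrtr_sqr ger0_norm ?expR_ge0.
have -> : cosh (`|2 * v - 1| * w) = cosh ((2 * v - 1) * w).
  by case: (ger0P (2 * v - 1)) => _ //; rewrite mulNr coshN.
rewrite sq.
have -> : t * v = w + (2 * v - 1) * w by rewrite tE; ring.
have -> : t * (1 - v) = w - (2 * v - 1) * w by rewrite tE; ring.
rewrite tE /cosh !expRD.
have w0 : expR w != 0 by rewrite gt_eqF ?expR_gt0.
set z := (2 * v - 1) * w; set y := expR (- w).
have -> : 2^-1 * (expR w * expR z + expR w * expR (- z)) =
    expR w * ((expR z + expR (- z)) / 2) by field.
have -> : s * expR w + (1 - s) * ((expR w * expR w + 1) / 2) =
    expR w * (s + (1 - s) * ((expR w + y) / 2)).
  by rewrite /y expRN; field.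
by rewrite -mulf_div divff// mul1r.
Qed.

Lemma mean_preceq_heinz_heron s v :
  mean_preceq (heinz_mean v) (heron_mean s) <->
  pd (fun u => cosh (`|2 * v - 1| * u) / (s + (1 - s) * cosh u)).
Proof.
rewrite /mean_preceq.
have -> : (fun t => (heinz_mean v (expR t) 1 / heron_mean s (expR t) 1)%:C%C) =
    (fun t => (cosh (`|2 * v - 1| * (2^-1 * t)) /
               (s + (1 - s) * cosh (2^-1 * t)))%:C%C : R[i]).
  by apply/funext => t; rewrite heinz_heron_ratio.
apply: (iff_trans (pd_positive_definite _)).
  by move=> x; rewrite !mulrN !coshN.
split=> [/(@pd_scale R _ 2)|]; last exact: (@pd_scale R _ 2^-1).
by congr pd; apply/funext => u; rewrite mulKf ?pnatr_eq0.
Qed.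

Lemma pd_cosh_eq0 a : 0 <= a -> pd (fun u => cosh (a * u)) -> a = 0.
Proof.
move=> a0 pf; have := pd_diff_functional 1 1 pf.
rewrite /= /shift_op mul0r cosh0 mulr0 cosh0 add0r sub0r mulrN coshN !mulr1.
move=> h; apply/eqP; rewrite eq_le a0 andbT leNgt; apply/negP => /cosh_gt1.
lra.
Qed.

End HeinzHeronRatio.

Theorem proposition3p9 (R : realType) (s v : R)
    (hs : 0 <= s <= 1) (hv : 0 <= v <= 1) :
  mean_preceq (heinz_mean v) (heron_mean s) <->
  [\/ [/\ 0 <= s <= 1 / 2, 1 / 2 <= v <= 1 &
          2 * v - 1 <= (pi / 2) / (pi - acos (s / (1 - s)))],
      [/\ 0 <= s <= 1 / 2, 0 <= v <= 1 / 2 &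
          1 - 2 * v <= (pi / 2) / (pi - acos (s / (1 - s)))]
    | s = 1 /\ v = 1 / 2].
Proof.
apply: (iff_trans (mean_preceq_heinz_heron s v)).
set a : R := `|2 * v - 1|; move: hs hv => /andP[s0 s1] /andP[v0 v1].
have a0 : 0 <= a by exact: normr_ge0.
have a01 : 0 <= a <= 1 by rewrite a0 ler_norml; lra.
have [->|s_neq1] := eqVneq s 1.
  split=> [pf|].
    have /(pd_cosh_eq0 a0)/eqP : pd (fun u => cosh (a * u)).
      by congr pd: pf; apply/funext => u; rewrite subrr mul0r addr0 divr1.
    by rewrite normr_eq0 => /eqP v2; constructor 3; split=> //; lra.
  case=> [[h _ _]|[h _ _]|[_ v2]]; [lra|lra|].
  have -> : a = 0 by apply/eqP; rewrite normr_eq0; apply/eqP; lra.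
  congr pd: (@pd_cst1 R); apply/funext => u.
  by rewrite mul0r cosh0 subrr mul0r addr0 divr1.
have {}s1 : 0 < 1 - s by rewrite subr_gt0 lt_neqAle s_neq1.
pose c := s / (1 - s); have c0 : 0 <= c by rewrite divr_ge0// ltW.
have c1E : (c <= 1) = (s <= 1 / 2).
  by rewrite /c ler_pdivrMr// mul1r; apply/idP/idP => ?; lra.
have pdE : pd (fun u => cosh (a * u) / (s + (1 - s) * cosh u)) <->
           pd (fun u => cosh (a * u) / (cosh u + c)).
  have s0' := ltW s1; have si0 : 0 <= (1 - s)^-1 by rewrite invr_ge0.
  have D0 u : s + (1 - s) * cosh u != 0.
    by rewrite gt_eqF//; have := cosh_ge1 u; nra.
  have E0 u : (s + (1 - s) * cosh u) = (1 - s) * (cosh u + c).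
    by rewrite /c; field; rewrite gt_eqF.
  split=> [/(pd_multiplier_pd (pd_multiplier_cst s0'))|
           /(pd_multiplier_pd (pd_multiplier_cst si0))];
    congr pd; apply/funext => u; rewrite E0 invfM.
    by rewrite mulrCA mulVKf ?gt_eqF.
  by rewrite mulrCA.
apply: (iff_trans pdE); apply: (iff_trans (pd_heinz_iff a01 c0)).
rewrite c1E -/c.
have condE : s <= 1 / 2 ->
    (a * (pi - acos c) <= pi / 2) = (a <= pi / 2 / (pi - acos c)).
  rewrite -c1E => c1.
  have c11 : -1 < c <= 1 by rewrite c1 andbT (lt_le_trans _ c0)// ltrN10.
  have pc : 0 < pi - acos c by rewrite subr_gt0 acos_ltpi.
  by rewrite (ler_pdivlMr _ _ pc).
split=> [[s2]|].
  rewrite condE// /a; have [v2|v2] := leP (1 / 2) v.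
    rewrite ger0_norm; last by lra.
    by move=> h; constructor 1; split; [lra|lra|].
  rewrite ler0_norm; last by lra.
  by move=> h; constructor 2; split; [lra|lra|lra].
case=> [[/andP[_ s2] v2 h]|[/andP[_ s2] v2 h]|[s1' _]].
- by split=> //; rewrite condE// /a ger0_norm//; lra.
- by split=> //; rewrite condE// /a ler0_norm//; lra.
- by rewrite s1' eqxx in s_neq1.
Qed.
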